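(* For every real $\alpha>0$ and every integer $k\geq 1$ there exist constants $C,c>0$ such that the following holds for all large enough integers $n$. Let $G_{\alpha}$ be a graph on $n$ vertices with $\delta(G_{\alpha})\geq \alpha n$, let $b\leq \frac{cn}{\ln n}$ be a positive integer, and let $p\geq \frac{Cb}{n^2}$. Then with probability at least $1-\exp(-c pn^2)$ the following holds: in the $(1:b)$ Maker-Breaker game played on the edges of $G_{\alpha}\cup G_{n,p}$, Maker has a strategy to claim a spanning $k$-vertex-connected graph.
   Context: $G_{n,p}$ denotes the binomial random graph on the vertex set of $G_\alpha$ (of size $n$), each pair being an edge independently with probability $p$; $G_\alpha \cup G_{n,p}$ is the union of the edge sets on this common vertex set. A $(1:b)$ Maker-Breaker game on a board $X$ with winning sets $\mathcal{F}\subseteq 2^X$: Maker and Breaker alternately claim previously unclaimed elements of $X$, Maker $1$ per round and Breaker $b$ per round (possibly fewer in the last round); Maker wins if she claims all elements of some $F\in\mathcal{F}$, otherwise Breaker wins. *)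

(* Defs.v *)
From HB Require Import structures.
From mathcomp Require Import all_boot all_order all_algebra.
From mathcomp Require Import boolp reals.

Set Implicit Arguments.
Unset Strict Implicit.
Unset Printing Implicit Defensive.

Import Order.TTheory GRing.Theory Num.Theory.

Inductive player := Maker | Breaker.

Section MakerBreaker.
Variable T : finType.

Inductive move := MakerClaims of T | BreakerClaims of {set T}.

(* The moves played so far, most recent first. *)
Definition history := seq move.

Fixpoint maker_claimed (h : history) : {set T} :=
  match h with
  | [::] => set0
  | MakerClaims x :: h' => x |: maker_claimed h'
  | BreakerClaims _ :: h' => maker_claimed h'
  end.

Fixpoint breaker_claimed (h : history) : {set T} :=
  match h with
  | [::] => set0
  | MakerClaims _ :: h' => breaker_claimed h'
  | BreakerClaims D :: h' => D :|: breaker_claimed h'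
  end.

Definition unclaimed (X : {set T}) (h : history) : {set T} :=
  X :\: (maker_claimed h :|: breaker_claimed h).

Definition maker_strategy := history -> T.

(* [play b X first sigma pl h]: the history [h] can arise when [first] moves
   first and Maker follows [sigma], and [pl] is next to move. Breaker claims
   exactly [b] elements, or all remaining ones when fewer than [b] are left. *)
Inductive play (b : nat) (X : {set T}) (first : player)
    (sigma : maker_strategy) : player -> history -> Prop :=
  | play_start : play b X first sigma first [::]
  | play_maker h :
      play b X first sigma Maker h ->
      unclaimed X h != set0 ->
      play b X first sigma Breaker (MakerClaims (sigma h) :: h)
  | play_breaker h (D : {set T}) :
      play b X first sigma Breaker h ->
      unclaimed X h != set0 ->
      D \subset unclaimed X h ->
      #|D| = minn b #|unclaimed X h| ->
      play b X first sigma Maker (BreakerClaims D :: h).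

Definition legal_strategy (b : nat) (X : {set T}) (first : player)
    (sigma : maker_strategy) : Prop :=
  forall h, play b X first sigma Maker h -> unclaimed X h != set0 ->
    sigma h \in unclaimed X h.

Definition winning_strategy (b : nat) (X : {set T}) (F : {set {set T}})
    (first : player) (sigma : maker_strategy) : Prop :=
  forall pl h, play b X first sigma pl h -> unclaimed X h = set0 ->
    exists2 W, W \in F & W \subset maker_claimed h.

Definition maker_wins (b : nat) (X : {set T}) (F : {set {set T}})
    (first : player) : Prop :=
  exists2 sigma, legal_strategy b X first sigma &
                 winning_strategy b X F first sigma.

End MakerBreaker.

Section Graphs.
Variable V : finType.

Definition pairs : {set {set V}} := [set e : {set V} | #|e| == 2].

(* A graph on V is given by its edge set, edges being two-element sets. *)
Definition is_graph (E : {set {set V}}) : bool := E \subset pairs.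

Definition degree (E : {set {set V}}) (v : V) : nat :=
  #|[set e in E | v \in e]|.

(* In a simple graph every degree is less than #|V|, so the default value of
   the iterated minimum plays no role when V is nonempty. *)
Definition min_degree (E : {set {set V}}) : nat :=
  \big[minn/#|V|]_(v : V) degree E v.

(* The graph obtained from (V, E) by deleting the vertices of S. *)
Definition connected_without (E : {set {set V}}) (S : {set V}) : bool :=
  [forall u in ~: S, forall v in ~: S,
     connect [rel x y | [&& x \notin S, y \notin S & [set x; y] \in E]] u v].

Definition k_connected (k : nat) (E : {set {set V}}) : bool :=
  (k < #|V|) && [forall S : {set V}, (#|S| < k) ==> connected_without E S].

(* The edge sets of the spanning k-vertex-connected subgraphs of (V, E). *)
Definition k_connected_subgraphs (k : nat) (E : {set {set V}}) :
    {set {set {set V}}} :=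
  [set F : {set {set V}} | (F \subset E) && k_connected k F].

Local Open Scope ring_scope.

(* The weight of E when each pair is an edge independently with probability p. *)
Definition gnp_weight (R : realType) (p : R) (E : {set {set V}}) : R :=
  \prod_(e in pairs) (if e \in E then p else 1 - p).

Definition gnp_prob (R : realType) (p : R) (A : {set {set V}} -> Prop) : R :=
  \sum_(E : {set {set V}} | is_graph E && `[< A E >]) gnp_weight p E.

End Graphs.

(* Main.v *)
Require Import Defs.
From HB Require Import structures.
From mathcomp Require Import all_boot all_order all_algebra.
From mathcomp Require Import boolp reals sequences exp.
From mathcomp Require Import ring lra zify.

Set Implicit Arguments.
Unset Strict Implicit.
Unset Printing Implicit Defensive.

Import Order.TTheory GRing.Theory Num.Theory.
Local Open Scope ring_scope.

(** Partition the vertices of G_alpha so as to minimize the sum of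
    [alpha / 2 * |W| ^ 2 - 2 * e(W)] over the classes W. Minimality makes every
    class of linear size and every cut (A, B) inside a class of density at least
    alpha / 2, hence of size linear in n * min(|A|, |B|). Split each class
    evenly into k colours. With the stated probability the random graph puts at
    least a large multiple of b edges between any two classes within any colour;
    there are only boundedly many such triples. By a potential argument in the
    style of Beck's biased Erdos-Selfridge criterion, Maker can claim an edge in
    each of these bipartite graphs and in each cut of a class from which fewer
    than k vertices have been deleted. The resulting graph is k-connected: when
    S with |S| < k is deleted, each class stays connected, and some colour avoids
    S, so any two classes are still joined by an edge. *)

(** * Beck's potential for the biased hitting game *)

Lemma expR_le1D2x (R : realType) (t : R) :
  0 <= t -> t <= 1 / 2 -> expR t <= 1 + 2 * t.
Proof.
move=> t0 t1; have := expR_ge1Dx (- t); rewrite expRN => h.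
have e0 := expR_gt0 t.
have h1 : (1 - t) * expR t <= 1.
  by have := ler_wpM2r (ltW e0) h; rewrite mulVf ?lt0r_neq0.
(* [(1 - t) * (1 + 2 * t) = 1 + t * (1 - 2 * t) >= 1 >= (1 - t) * expR t]. *)
have h2 : (1 - t) * (expR t - (1 + 2 * t)) <= 0.
  have : 0 <= t * (1 - 2 * t) by apply: mulr_ge0 => //; lra.
  nra.
have : 0 < 1 - t by lra.
by move=> h3; move: h2; rewrite pmulr_rle0 // subr_le0.
Qed.

Section Potential.
Variables (R : realType) (T : finType) (b : nat) (F : seq {set T}).
Hypothesis b0 : (0 < b)%N.

(* The factor 2 leaves room for [exp (m / 2b) <= 1 + m / b] when [m <= b], so that
   a Breaker move raises the potential at most linearly in the set claimed. *)
Definition danger (M B A : {set T}) : R :=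
  if [disjoint A & M] then expR (- (#|A :\: B|%:R / (2 * b%:R))) else 0.

Definition potential (M B : {set T}) : R := \sum_(A <- F) danger M B A.

Definition danger_at (M B : {set T}) (x : T) : R :=
  \sum_(A <- F | x \in A) danger M B A.

Lemma danger_ge0 M B A : 0 <= danger M B A.
Proof. by rewrite /danger; case: ifP => // _; rewrite expR_ge0. Qed.

Lemma danger_maker M B A x :
  danger (x |: M) B A = if x \in A then 0 else danger M B A.
Proof.
rewrite /danger; case: ifPn => [d|nd].
  have /setP/(_ x) := disjoint_setI0 d.
  rewrite !inE eqxx andbT => ->.
  suff -> : [disjoint A & M] by [].
  by apply: disjointWr d; apply: subsetUr.
case: ifPn => // xA; case: ifPn => // d.
case/negP: nd; rewrite disjoint_sym -setI_eq0 setIUl setU_eq0.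
apply/andP; split; last by rewrite setI_eq0 disjoint_sym.
by rewrite setI_eq0 disjoints1.
Qed.

Lemma potential_maker M B x :
  potential (x |: M) B = potential M B - danger_at M B x.
Proof.
rewrite /potential /danger_at [X in X - _](bigID (fun A : {set T} => x \in A)) /=.
rewrite addrAC subrr add0r [LHS](bigID (fun A : {set T} => x \in A)) /= big1 ?add0r.
  by apply: eq_bigr => A /negbTE xA; rewrite danger_maker xA.
by move=> A xA; rewrite danger_maker xA.
Qed.

Lemma danger_at_maker M B x y : danger_at (x |: M) B y <= danger_at M B y.
Proof.
apply: ler_sum => A _; rewrite danger_maker; case: ifP => // _.
exact: danger_ge0.
Qed.

Lemma danger_breaker M B A (D : {set T}) : (#|D| <= b)%N ->
  danger M (D :|: B) A <= danger M B A * (1 + #|A :&: D|%:R / b%:R).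
Proof.
 move=> Db; rewrite /danger; case: ifP => _; last by rewrite mul0r.
have b0' : 0 < b%:R :> R by rewrite ltr0n.
have mb : #|A :&: D|%:R <= b%:R :> R.
  by rewrite ler_nat (leq_trans _ Db) // subset_leq_card // subsetIr.
have e : 1 + #|A :&: D|%:R / b%:R = 1 + 2 * (#|A :&: D|%:R / (2 * b%:R)) :> R.
  by field; rewrite gt_eqF.
apply: (@le_trans _ _ (expR (- (#|A :\: B|%:R / (2 * b%:R))) *
   expR (#|A :&: D|%:R / (2 * b%:R)))); last first.
  rewrite ler_pM2l ?expR_gt0 // e expR_le1D2x //.
  - by rewrite divr_ge0 ?ler0n // mulr_ge0 // ltW.
  - by rewrite ler_pdivrMr ?mulr_gt0 //; lra.
rewrite -expRD ler_expR -!mulNr -mulrDl ler_pM2r ?invr_gt0 ?mulr_gt0 //.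
suff : #|A :\: B|%:R <= #|A :\: (D :|: B)|%:R + #|A :&: D|%:R :> R by lra.
rewrite -natrD ler_nat.
have : A :\: B \subset (A :\: (D :|: B)) :|: (A :&: D).
  by apply/subsetP => z; rewrite !inE; case: (z \in A); case: (z \in B); case: (z \in D).
by move=> /subset_leq_card/leq_trans; apply; rewrite cardsU leq_subr.
Qed.

(** The linear factor in [danger_breaker] counts [A] once for each element of [A :&: D]; exchanging
    the sums turns this into the dangers at the elements of [D]. *)
Lemma potential_breaker M B (D : {set T}) : (#|D| <= b)%N ->
  potential M (D :|: B) <=
  potential M B + (\sum_(y in D) danger_at M B y) / b%:R.
Proof.
move=> Db.
have -> : \sum_(y in D) danger_at M B y =
   \sum_(A <- F) danger M B A * #|A :&: D|%:R.
  rewrite /danger_at (exchange_big_dep predT) //=; apply: eq_bigr => A _.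
  rewrite sumr_const mulr_natr; congr (_ *+ _); apply: eq_card => z.
  by rewrite !inE andbC.
rewrite mulr_suml -big_split /=; apply: ler_sum => A _.
by apply: (le_trans (danger_breaker _ _ _ Db)); rewrite mulrDr mulr1 mulrA.
Qed.

(** Each set gains a factor of at most 2, since [A :&: D] has at most [b] elements. This serves for
    an opening move of Breaker, which no move of Maker compensates. *)
Lemma potential_breaker2 M B (D : {set T}) : (#|D| <= b)%N ->
  potential M (D :|: B) <= 2 * potential M B.
Proof.
move=> Db; rewrite mulr_sumr; apply: ler_sum => A _.
apply: (le_trans (danger_breaker _ _ _ Db)).
rewrite [leRHS]mulrC ler_wpM2l ?danger_ge0 //.
have b0' : 0 < b%:R :> R by rewrite ltr0n.
suff : #|A :&: D|%:R / b%:R <= 1 :> R by lra.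
rewrite ler_pdivrMr // mul1r ler_nat (leq_trans _ Db) //.
by rewrite subset_leq_card // subsetIr.
Qed.

(** Maker's claim gains [danger_at M B x] and only lowers the dangers at [D]. Breaker's reply then
    costs at most [b] such dangers divided by [b], each at most the gain. *)
Lemma potential_round M B (D : {set T}) x : (#|D| <= b)%N ->
  (forall y, y \in D -> danger_at M B y <= danger_at M B x) ->
  potential (x |: M) (D :|: B) <= potential M B.
Proof.
move=> Db xmax; apply: (le_trans (potential_breaker _ _ Db)).
have b0' : 0 < b%:R :> R by rewrite ltr0n.
rewrite potential_maker addrAC -addrA gerDl subr_le0.
rewrite ler_pdivrMr //.
apply: (@le_trans _ _ (\sum_(y in D) danger_at M B x)).
  by apply: ler_sum => y yD; exact: le_trans (danger_at_maker _ _ _ _) (xmax _ yD).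
rewrite sumr_const -[leLHS]mulr_natr ler_wpM2l ?ler_nat //.
by apply: sumr_ge0 => A _; exact: danger_ge0.
Qed.

Lemma potential_ge1 (M B A : {set T}) : A \in F -> [disjoint A & M] -> A \subset B ->
  1 <= potential M B.
Proof.
move=> AF AM AB; rewrite /potential (perm_big _ (perm_to_rem AF)) big_cons.
have -> : danger M B A = 1.
  have /eqP AB0 : A :\: B == set0 by rewrite setD_eq0.
  by rewrite /danger AM AB0 cards0 mul0r oppr0 expR0.
by rewrite lerDl; apply: sumr_ge0 => *; exact: danger_ge0.
Qed.

End Potential.

(** Maker always claims an unclaimed element of largest danger. No round of a Maker move and
    Breaker's reply raises the potential, so it stays below 1 and no set falls entirely to Breaker.
    The bound [2^-1] leaves a factor 2 for an opening move of Breaker. *)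
Lemma hitting_criterion (R : realType) (T : finType) (x0 : T) (b : nat)
    (X : {set T}) (F : seq {set T}) :
  (0 < b)%N -> (forall A, A \in F -> A \subset X) ->
  \sum_(A <- F) expR (- (#|A|%:R / (2 * b%:R))) < 2^-1 :> R ->
  forall first, exists2 sigma : maker_strategy T, legal_strategy b X first sigma &
    forall pl h, play b X first sigma pl h -> unclaimed X h = set0 ->
      forall A, A \in F -> exists2 x, x \in A & x \in maker_claimed h.
Proof.
move=> b0 FX small first.
pose pot := potential R b F; pose at_ := danger_at R b F.
pose best (h : history T) x := x \in unclaimed X h /\ forall y, y \in unclaimed X h ->
  at_ (maker_claimed h) (breaker_claimed h) y <= at_ (maker_claimed h) (breaker_claimed h) x.
have /choice[sigma sigmaP] : forall h, exists x, unclaimed X h != set0 -> best h x.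
  move=> h; have [_|/set0Pn[x xU]] := eqVneq (unclaimed X h) set0; first by exists x0.
  case: (@arg_maxP _ _ _ x (mem (unclaimed X h))
    (at_ (maker_claimed h) (breaker_claimed h)) xU) => y yU ymax.
  by exists y => _; split.
exists sigma => [h _ /sigmaP[] //|].
(* Rounds pair a Maker move with the reply to it, so on Breaker's turn the invariant speaks of the
   position after every possible reply. *)
have inv pl h : play b X first sigma pl h ->
    if pl is Maker then is_true (pot (maker_claimed h) (breaker_claimed h) < 1)
    else forall D : {set T}, D \subset unclaimed X h -> (#|D| <= b)%N ->
      pot (maker_claimed h) (D :|: breaker_claimed h) < 1.
  have start : 2 * pot set0 set0 < 1.
    rewrite mulrC -ltr_pdivlMr // mul1r; apply: le_lt_trans small.
    apply: ler_sum => A _; rewrite /danger setD0 disjoint_sym.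
    by rewrite -setI_eq0 set0I eqxx.
  elim=> [|{}h _ IH U|{}h D _ IH U DU Db] /=.
  - case: first {sigmaP} => [|D _ Db] /=.
      apply: le_lt_trans start; rewrite mulr2n mulrDl mul1r lerDl.
      by apply: sumr_ge0 => *; exact: danger_ge0.
    by apply: le_lt_trans (potential_breaker2 R F b0 set0 set0 Db) start.
  - move=> D DU Db; apply: le_lt_trans IH; apply: potential_round => // y yD.
    have [_] := sigmaP _ U; apply.
    have := subsetP DU _ yD; rewrite /unclaimed /= !inE negb_or.
    by case: (y == sigma h) => /=; case: (y \in maker_claimed h).
  - by apply: IH => //; rewrite Db geq_minl.
move=> pl h /inv ph U A AF.
have {}ph : pot (maker_claimed h) (breaker_claimed h) < 1.
  (* On Breaker's turn the empty reply gives the bound for the final position itself. *)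
  by case: pl ph => // /(_ set0); rewrite sub0set cards0 set0U; exact.
have [AM|] := boolP [disjoint A & maker_claimed h]; last first.
  by rewrite -setI_eq0 => /set0Pn[x /setIP[xA xM]]; exists x.
suff /(potential_ge1 R b AF AM) : A \subset breaker_claimed h.
  by rewrite leNgt ph.
apply/subsetP => x xA; apply: contraT => xB.
suff : x \in unclaimed X h by rewrite U inE.
rewrite !inE (negbTE xB) orbF (subsetP (FX _ AF)) // andbT.
by have /setP/(_ x) := disjoint_setI0 AM; rewrite !inE xA /= => ->.
Qed.

(** * Vertex labellings of least total cost *)

Definition label_class (V L : finType) (phi : V -> L) (i : L) : {set V} :=
  [set x | phi x == i].

Section OptimalLabelling.
Variables (R : realType) (V : finType) (g : {set V} -> R).
Hypothesis g0 : g set0 = 0.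

Let cost (phi : {ffun V -> option V}) := \sum_i g (label_class phi i).

Let cost_two (phi psi : {ffun V -> option V}) i j : i != j ->
  (forall l, l != i -> l != j -> label_class psi l = label_class phi l) ->
  cost phi <= cost psi ->
  g (label_class phi i) + g (label_class phi j) <=
  g (label_class psi i) + g (label_class psi j).
Proof.
move=> ij same; rewrite /cost.
rewrite (bigD1 i) //= (bigD1 j) 1?eq_sym //= [leRHS](bigD1 i) //=.
rewrite [X in _ <= _ + X](bigD1 j) 1?eq_sym //=.
rewrite [X in _ -> _ <= X]addrC.
have -> : \sum_(l | (l != i) && (l != j)) g (label_class psi l) =
   \sum_(l | (l != i) && (l != j)) g (label_class phi l).
  by apply: eq_bigr => l /andP[li lj]; rewrite same.
lra.
Qed.

Lemma optimal_labelling : exists phi : V -> option V,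
  (forall i (A : {set V}), A \subset label_class phi i ->
     g (label_class phi i) <= g A + g (label_class phi i :\: A)) /\
  (forall i j, i != j -> g (label_class phi i) + g (label_class phi j) <=
     g (label_class phi i :|: label_class phi j)).
Proof.
have [phi _ phimin] := @arg_minP _ _ _ [ffun x : V => None] xpredT cost isT.
exists phi; split=> [i A AW|i j ij]; last first.
  pose psi := [ffun x => if phi x == j then i else phi x].
  have -> : label_class phi i :|: label_class phi j = label_class psi i.
    apply/setP => x; rewrite !inE ffunE.
    by have [->|_] := eqVneq (phi x) j; rewrite ?eqxx ?orbT ?orbF.
  have psij : label_class psi j = set0.
    apply/setP => x; rewrite !inE ffunE.
    by have [_|/negbTE //] := eqVneq (phi x) j; rewrite (negbTE ij).
  rewrite -[leRHS]addr0 -g0 -psij; apply: cost_two => // [l li lj|]; last exact: phimin.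
  apply/setP => x; rewrite !inE ffunE.
  by have [->|//] := eqVneq (phi x) j; rewrite (eq_sym i) (negbTE li) (eq_sym j) (negbTE lj).
have [j jphi] : exists j, j \notin codom phi.
  apply/existsP; rewrite -negb_forall; apply/negP => /forallP all_in.
  have := leq_image_card phi predT; rewrite -[#|image _ _|]/(#|codom phi|).
  by rewrite (eq_card (all_in : codom phi =i predT)) card_option ltnn.
have phij : label_class phi j = set0.
  apply/setP => x; rewrite !inE; apply: contraNF jphi => /eqP <-; exact: codom_f.
have [ij|ij] := eqVneq i j.
  by move: AW; rewrite ij phij subset0 => /eqP ->; rewrite setD0 g0 addr0.
pose psi := [ffun x => if x \in A then j else phi x].
have -> : label_class phi i :\: A = label_class psi i.
  apply/setP => x; rewrite !inE ffunE.
  by case: ifP => //= _; rewrite (eq_sym j) (negbTE ij).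
have psij : label_class psi j = A.
  apply/setP => x; rewrite !inE ffunE; case: ifP => [_|_]; first by rewrite eqxx.
  by have /setP/(_ x) := phij; rewrite !inE.
rewrite -[leLHS]addr0 -g0 -{1}phij -psij [leRHS]addrC.
apply: cost_two => // [l li lj|]; last exact: phimin.
apply/setP => x; rewrite !inE ffunE; case: ifP => // xA.
have := subsetP AW _ xA; rewrite inE => /eqP ->.
by rewrite (eq_sym j) (negbTE lj) (eq_sym i) (negbTE li).
Qed.

End OptimalLabelling.

(** * Adjacency counts, cuts, and density of the optimal partition *)

Section EdgeCounts.
Variables (V : finType).
Implicit Types (G : {set {set V}}) (A B C W : {set V}).

(** Ordered pairs are counted: in a graph, [adjacencies G W W] is twice the number of edges inside
    [W], while for disjoint sets each crossing edge counts once. *)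
Definition adjacencies G A B : nat :=
  (\sum_(x in A) \sum_(y in B) ([set x; y] \in G))%N.

Definition cut_edges G A B : {set {set V}} :=
  [set e in G | [exists x in A, exists y in B, e == [set x; y]]].

Lemma cut_sub G A B : cut_edges G A B \subset G.
Proof. by apply/subsetP => e; rewrite inE => /andP[]. Qed.

Lemma in_cut G A B e : e \in cut_edges G A B ->
  exists x y, [/\ x \in A, y \in B & e = [set x; y]].
Proof.
rewrite inE => /andP[_ /existsP[x /andP[xA /existsP[y /andP[yB /eqP ->]]]]].
by exists x, y.
Qed.

Lemma adjacencies_sym G A B : adjacencies G A B = adjacencies G B A.
Proof.
rewrite /adjacencies exchange_big /=; apply: eq_bigr => x _.
by apply: eq_bigr => y _; rewrite setUC.
Qed.

Lemma adjacencies_subl G A B W : A \subset W ->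
  adjacencies G W B = (adjacencies G A B + adjacencies G (W :\: A) B)%N.
Proof. by move=> AW; rewrite /adjacencies (big_setID A) /= (setIidPr AW). Qed.

Lemma adjacencies_subr G A B W : B \subset W ->
  adjacencies G A W = (adjacencies G A B + adjacencies G A (W :\: B))%N.
Proof.
by move=> BW; rewrite !(adjacencies_sym _ A) (adjacencies_subl _ _ BW).
Qed.

Lemma adjacencies_le G A B : (adjacencies G A B <= #|A| * #|B|)%N.
Proof.
rewrite /adjacencies -sum_nat_const; apply: leq_sum => x _.
rewrite -[X in (_ <= X)%N]muln1 -sum_nat_const; apply: leq_sum => y _.
exact: leq_b1.
Qed.

Lemma degree_le G x : is_graph G -> (degree G x <= adjacencies G [set x] setT)%N.
Proof.
move=> gG; rewrite /adjacencies big_set1.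
have -> : (\sum_(y in [set: V]) ([set x; y] \in G) = #|[set y | [set x; y] \in G]|)%N.
  rewrite -sum1dep_card [RHS]big_mkcond /=.
  by apply: eq_big => [y|y _]; [rewrite inE | case: ifP].
apply: leq_trans (leq_imset_card (fun y => [set x; y]) _).
rewrite /degree; apply/subset_leq_card/subsetP => e; rewrite !inE => /andP[eG xe].
have := subsetP gG _ eG; rewrite inE => /cards2P[u [v [uv e_uv]]].
have [y ey] : exists y, e = [set x; y].
  move: xe; rewrite e_uv !inE => /orP[] /eqP ->; first by exists v.
  by exists u; rewrite setUC.
by apply/imsetP; exists y => //; rewrite inE -ey.
Qed.

(** Two ordered pairs with the same underlying set could differ only by a swap of endpoints, which
    disjointness excludes. *)
Lemma pair_set_inj A B : [disjoint A & B] ->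
  {in setX A B &, injective (fun u : V * V => [set u.1; u.2])}.
Proof.
move=> /disjoint_setI0/setP dAB [x y] [x' y'] /setXP[/= xA yB] /setXP[/= xA' yB'] e.
have := dAB x; have := dAB y; rewrite !inE xA yB andbT /= => yA xB.
have : x \in [set x'; y'] by rewrite -e set21.
have : y \in [set x'; y'] by rewrite -e set22.
rewrite !inE => /orP[/eqP yx'|/eqP ->]; first by rewrite yx' xA' in yA.
by move=> /orP[/eqP ->|/eqP xy'] //; rewrite xy' yB' in xB.
Qed.

Lemma card_cut G A B : [disjoint A & B] -> #|cut_edges G A B| = adjacencies G A B.
Proof.
move=> dAB; pose D := [set u in setX A B | [set u.1; u.2] \in G].
have -> : cut_edges G A B = [set [set u.1; u.2] | u in D].
  apply/setP => e; apply/idP/imsetP => [eAB|[[x y]]].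
    have [x [y [xA yB exy]]] := in_cut eAB; exists (x, y) => //.
    by rewrite !inE /= xA yB -exy (subsetP (cut_sub _ _ _) _ eAB).
  rewrite !inE => /andP[/andP[/= xA yB] eG] ->; rewrite eG /=.
  by apply/existsP; exists x; rewrite xA; apply/existsP; exists y; rewrite yB eqxx.
rewrite card_in_imset => [|u v uD vD]; last first.
  by apply: (pair_set_inj dAB); [move: uD|move: vD]; rewrite inE => /andP[].
rewrite /adjacencies pair_big_dep /= -sum1dep_card big_mkcondr /=.
by apply: eq_big => [u|u _]; rewrite ?inE //; case: ifP.
Qed.

Lemma adjacencies_mono G (X : {set {set V}}) A B : G \subset X ->
  (adjacencies G A B <= adjacencies X A B)%N.
Proof.
move=> GX; apply: leq_sum => x _; apply: leq_sum => y _.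
by case: (boolP (_ \in G)) => // /(subsetP GX) ->.
Qed.

Lemma min_degree_le G x : (min_degree G <= degree G x)%N.
Proof.
rewrite /min_degree; have : x \in index_enum V by rewrite mem_index_enum.
elim: (index_enum V) => // y s IH; rewrite big_cons inE => /orP[/eqP <-|/IH h].
  exact: geq_minl.
exact: leq_trans (geq_minr _ _) h.
Qed.

End EdgeCounts.

(* Splitting a class of an optimal labelling does not pay, so its cuts are dense;
   merging two classes does not pay, so pairs of classes are sparse, and by the
   minimum degree condition classes are large. *)
Lemma robust_partition (R : realType) (V : finType) (G : {set {set V}}) (alpha : R) :
  0 <= alpha -> is_graph G -> alpha * #|V|%:R <= (min_degree G)%:R ->
  exists phi : V -> option V,
    (forall i, label_class phi i != set0 ->
       alpha / 2 * #|V|%:R <= #|label_class phi i|%:R) /\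
    (forall i (A : {set V}), A \subset label_class phi i ->
       alpha / 2 * #|A|%:R * #|label_class phi i :\: A|%:R <=
       (adjacencies G A (label_class phi i :\: A))%:R).
Proof.
move=> a0 gG mindeg.
pose g (W : {set V}) : R := alpha / 2 * #|W|%:R ^+ 2 - (adjacencies G W W)%:R.
have g0 : g set0 = 0.
  by rewrite /g /adjacencies big_set0 cards0 expr0n mulr0 subrr.
(* The square loses its cross term, and the adjacency count loses the crossing pairs in both
   orders. *)
have gsplit (A W : {set V}) : A \subset W -> g A + g (W :\: A) - g W =
    2 * (adjacencies G A (W :\: A))%:R - alpha * #|A|%:R * #|W :\: A|%:R.
  move=> AW; rewrite /g (adjacencies_subl _ _ AW) !(adjacencies_subr _ _ AW).
  rewrite (adjacencies_sym G (W :\: A) A) -(cardsID A W) (setIidPr AW) !natrD.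
  by field.
have [phi [split merge]] := optimal_labelling g0.
exists phi; split=> [i Wi|i A AW]; last first.
  by have := split _ _ AW; have := gsplit _ _ AW; lra.
set W := label_class phi i in Wi *.
have W0 : 0 < #|W|%:R :> R by rewrite ltr0n card_gt0.
have sparse j : j != i ->
    (adjacencies G W (label_class phi j))%:R <=
    alpha / 2 * #|W|%:R * #|label_class phi j|%:R :> R.
  move=> ji; set U := label_class phi j.
  have ij : i != j by rewrite eq_sym.
  have UE : (W :|: U) :\: W = U.
    apply/setP => x; rewrite !inE; case: (eqVneq (phi x) i) => //= ->.
    by rewrite (negbTE ij).
  (* Splitting the union along [W] undoes the merge, so [gsplit] gives the exact effect of
     merging. *)
  have := gsplit _ _ (subsetUl W U); rewrite UE.
  have := merge _ _ ij; rewrite -/W -/U; lra.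
have total : alpha * #|V|%:R * #|W|%:R <= (adjacencies G W setT)%:R.
  have -> : adjacencies G W setT = (\sum_(x in W) adjacencies G [set x] setT)%N.
    by apply: eq_bigr => x _; rewrite /adjacencies big_set1.
  rewrite natr_sum mulr_natr -sumr_const; apply: ler_sum => x _.
  apply: (le_trans mindeg); rewrite ler_nat.
  exact: leq_trans (min_degree_le _ _) (degree_le _ gG).
have byclass (F : V -> nat) : (\sum_(x in [set: V]) F x =
    \sum_j \sum_(x in label_class phi j) F x)%N.
  rewrite (partition_big phi xpredT) //=; apply: eq_bigr => j _.
  by apply: eq_bigl => x; rewrite !inE.
have adjE : adjacencies G W setT = (\sum_j adjacencies G W (label_class phi j))%N.
  rewrite adjacencies_sym /adjacencies byclass; apply: eq_bigr => j _.
  by rewrite -/(adjacencies _ _ _) adjacencies_sym.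
have cardE : #|V| = (\sum_j #|label_class phi j|)%N.
  rewrite -cardsT -sum1_card byclass; apply: eq_bigr => j _; exact: sum1_card.
(* With [n = #|V|] and [w = #|W|], the bounds combine to [alpha * n * w <= w ^ 2 + alpha / 2 * w *
   n], which is the claim multiplied by [w]. *)
rewrite -(ler_pM2r W0).
have inner : (adjacencies G W W)%:R <= #|W|%:R * #|W|%:R :> R.
  by rewrite -natrM ler_nat adjacencies_le.
have outer : \sum_(j | j != i) (adjacencies G W (label_class phi j))%:R <=
    alpha / 2 * #|W|%:R * \sum_(j | j != i) #|label_class phi j|%:R :> R.
  by rewrite mulr_sumr; apply: ler_sum.
have Vle : \sum_(j | j != i) #|label_class phi j|%:R <= #|V|%:R :> R.
  by rewrite cardE natr_sum [leRHS](bigD1 i) //= lerDr ler0n.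
move: total; rewrite adjE natr_sum (bigD1 i) //= -/W => total.
have : alpha / 2 * #|W|%:R * \sum_(j | j != i) #|label_class phi j|%:R <=
   alpha / 2 * #|W|%:R * #|V|%:R.
  by rewrite ler_wpM2l // mulr_ge0 ?(ltW W0) // divr_ge0.
lra.
Qed.

(** * Balanced colouring of the classes *)

Definition colour_class (V L : finType) (k : nat) (phi : V -> L) (chi : V -> 'I_k)
  i c : {set V} := [set x in label_class phi i | chi x == c].

(** Each vertex is coloured by its position in its class modulo [k]. A class [W] then has at least
    [#|W| %/ k] vertices of each colour, and the successor covers the remainder. *)
Lemma balanced_colouring (V L : finType) (phi : V -> L) (k : nat) : (0 < k)%N ->
  exists chi : V -> 'I_k, forall i c,
    (#|label_class phi i| <= k * #|colour_class phi chi i c|.+1)%N.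
Proof.
move=> k0.
exists (fun x => Ordinal (ltn_pmod (index x (enum (label_class phi (phi x)))) k0)).
move=> i c; set W := label_class phi i; set D := colour_class _ _ _ _.
have [->|/set0Pn[x0 _]] := eqVneq W set0; first by rewrite cards0.
have idx (t : 'I_(#|W| %/ k)) : (c + k * t < size (enum W))%N.
  rewrite -cardE; apply: leq_trans (leq_divM #|W| k).
  by have := ltn_ord c; have := ltn_ord t; move: (#|W| %/ k)%N t => m t; nia.
pose f (t : 'I_(#|W| %/ k)) := nth x0 (enum W) (c + k * t).
have finj : injective f.
  move=> s t /eqP; rewrite nth_uniq ?enum_uniq // eqn_add2l eqn_pmul2l //.
  by move=> /eqP/val_inj.
have fD : f @: setT \subset D.
  apply/subsetP => _ /imsetP[t _ ->].
  have fW : f t \in W by rewrite -mem_enum mem_nth.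
  rewrite !inE; move: (fW); rewrite inE => /eqP fi; rewrite fi eqxx /=.
  apply/eqP/val_inj => /=; rewrite -/W index_uniq ?enum_uniq // addnC mulnC modnMDl.
  by rewrite modn_small.
have := subset_leq_card fD; rewrite card_imset // cardsT card_ord => h.
have := ltn_ceil #|W| k0; rewrite mulnC => /ltnW/leq_trans; apply.
by rewrite leq_pmul2l.
Qed.

(** * Lower tails in the binomial random graph *)

Section RandomGraph.
Variables (R : realType) (V : finType) (p : R).

(** A product of sums [f e + h e] over all vertex sets [e] expands into a sum over all families [E].
    Setting [f = 0] and [h = 1] off the pairs removes the families that are not graphs. *)
Lemma gnp_generating_function (D : {set {set V}}) (q : R) : D \subset pairs V ->
  \sum_(E : {set {set V}} | is_graph E) gnp_weight p E * q ^+ #|E :&: D| =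
  (1 - p + p * q) ^+ #|D|.
Proof.
move=> Dp.
pose f e : R := if e \in pairs V then p * (if e \in D then q else 1) else 0.
pose h e : R := if e \in pairs V then 1 - p else 1.
transitivity (\prod_(e : {set V}) (f e + h e)); last first.
  rewrite (bigID (mem D)) /= [X in _ * X]big1 ?mulr1 => [|e eD]; last first.
    rewrite /f /h (negbTE eD) mulr1; case: ifP => _; last by rewrite add0r.
    by rewrite addrC subrK.
  rewrite -prodr_const; apply: eq_bigr => e eD.
  by rewrite /f /h (subsetP Dp _ eD) eD addrC.
rewrite bigA_distr [RHS](bigID (fun E : {set {set V}} => is_graph E)) /=.
rewrite [X in _ + X]big1 ?addr0 => [|E]; last first.
  move=> /subsetPn[e eE ep].
  by rewrite (bigD1 e) //= eE /f (negbTE ep) mul0r.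
apply: eq_bigr => E gE.
have -> : q ^+ #|E :&: D| = \prod_(e in pairs V) (if e \in E :&: D then q else 1).
  rewrite -big_mkcondr -prodr_const; apply: eq_bigl => e; rewrite inE.
  by case: (boolP (e \in E)) => [/(subsetP gE) ->|_]; rewrite ?andbF.
rewrite -big_split /= [RHS](bigID (mem (pairs V))) /= [X in _ * X]big1 ?mulr1 => [|e ep].
  apply: eq_bigr => e ep; rewrite /f /h ep inE.
  by case: (e \in E) => //=; rewrite mulr1.
rewrite /h (negbTE ep); case: ifP => // /(subsetP gE).
by rewrite (negbTE ep).
Qed.

Lemma gnp_weight_ge0 (E : {set {set V}}) : 0 <= p -> p <= 1 -> 0 <= gnp_weight p E.
Proof. by move=> p0 p1; apply: prodr_ge0 => e _; case: ifP => // _; lra. Qed.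

(** The generating function at [q = expR (- 1) <= 1 / 2] has base at most
    [1 - p / 2 <= expR (- (p / 2))]. *)
Lemma gnp_tail (D : {set {set V}}) (t : R) : 0 <= p -> p <= 1 -> D \subset pairs V ->
  \sum_(E : {set {set V}} | is_graph E) gnp_weight p E * expR (t - #|E :&: D|%:R)
  <= expR (t - p * #|D|%:R / 2).
Proof.
move=> p0 p1 Dp.
have -> : \sum_(E : {set {set V}} | is_graph E) gnp_weight p E * expR (t - #|E :&: D|%:R)
  = expR t * (1 - p + p * expR (- 1)) ^+ #|D|.
  rewrite -gnp_generating_function // mulr_sumr; apply: eq_bigr => E _.
  by rewrite expRD mulrCA -expRM_natl mulrN1.
rewrite expRD ler_pM2l ?expR_gt0 //.
have -> : - (p * #|D|%:R / 2) = #|D|%:R * - (p / 2) by field.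
rewrite expRM_natl.
have e1 : expR (- 1) <= 2^-1 :> R.
  rewrite expRN lef_pV2 ?posrE ?expR_gt0 //.
  by have := expR_ge1Dx (1 : R); lra.
have := expR_gt0 (- 1 : R) => e0.
apply: lerXn2r; rewrite ?nnegrE ?expR_ge0 //; first nra.
by have := expR_ge1Dx (- (p / 2)); nra.
Qed.

(* Exponential Markov inequality with a union bound, applied pointwise. *)
Lemma gnp_prob_ge (I : finType) (P : pred I) (D : I -> {set {set V}}) (t : R)
    (A : {set {set V}} -> Prop) :
  0 <= p -> p <= 1 -> (forall i, P i -> D i \subset pairs V) ->
  (forall E, (forall i, P i -> t <= #|E :&: D i|%:R) -> A E) ->
  1 - \sum_(i | P i) expR (t - p * #|D i|%:R / 2) <= gnp_prob p A.
Proof.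
move=> p0 p1 Dp PA.
have total : \sum_(E : {set {set V}} | is_graph E) gnp_weight p E = 1.
  have := gnp_generating_function 1 (sub0set (pairs V)).
  by rewrite cards0 expr0 => <-; apply: eq_bigr => E _; rewrite expr1n mulr1.
apply: (@le_trans _ _ (1 - \sum_(i | P i) \sum_(E : {set {set V}} | is_graph E)
    gnp_weight p E * expR (t - #|E :&: D i|%:R))).
  by rewrite lerD2l lerN2; apply: ler_sum => i Pi; rewrite gnp_tail ?Dp.
rewrite exchange_big /= -[X in X - _]total -sumrB /gnp_prob big_mkcondr /=.
apply: ler_sum => E gE; rewrite -mulr_sumr.
have w0 := gnp_weight_ge0 E p0 p1.
case: asboolP => [_|nA].
  by rewrite gerBl mulr_ge0 // sumr_ge0 // => i _; exact: expR_ge0.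
rewrite subr_le0 -[leLHS]mulr1 ler_wpM2l //.
(* Where [A] fails, some [D i] contains fewer than [t] edges of [E], and its exponential alone is at
   least 1. *)
have [i Pi lti] : exists2 i, P i & #|E :&: D i|%:R < t.
  apply: contrapT => h; apply: nA; apply: PA => i Pi.
  by rewrite leNgt; apply/negP => lti; apply: h; exists i.
rewrite (bigD1 i) //= -[leLHS]addr0; apply: lerD.
  by rewrite -[leLHS]expR0 ler_expR subr_ge0 ltW.
by apply: sumr_ge0 => j _; exact: expR_ge0.
Qed.

End RandomGraph.

(** * Total weight of the cuts inside classes *)

Lemma sum_set_exp (R : comPzRingType) (V : finType) (q : R) :
  \sum_(A : {set V}) q ^+ #|A| = (1 + q) ^+ #|V|.
Proof.
rewrite addrC -[#|V|]/(#|xpredT : pred V|) -prodr_const bigA_distr.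
apply: eq_bigr => A _; rewrite -big_mkcond /=.
by rewrite -prodr_const.
Qed.

Lemma sum_set_exp_le4 (R : realType) (V : finType) :
  \sum_(A : {set V}) (#|V|%:R^-1 : R) ^+ #|A| <= 4.
Proof.
rewrite sum_set_exp; have [->|n0] := eqVneq #|V| 0%N; first by rewrite expr0; lra.
have n0' : #|V|%:R != 0 :> R by rewrite pnatr_eq0.
apply: (@le_trans _ _ (expR #|V|%:R^-1 ^+ #|V|)).
  by apply: lerXn2r; rewrite ?nnegrE ?expR_ge0 ?addr_ge0 ?invr_ge0 ?expR_ge1Dx.
rewrite -expRM_natl divff //.
(* [expR (1 / 2) <= 2], and squaring gives [expR 1 <= 4]. *)
have := @expR_le1D2x R (1 / 2); rewrite divr_ge0 // => /(_ isT (lexx _)).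
have -> : expR 1 = expR (1 / 2) * expR (1 / 2) :> R by rewrite -expRD; congr expR; field.
have := expR_gt0 (1 / 2 : R); nra.
Qed.

(** From [|A| >= 1] and [|S| < k] follows [|A| * (k + 3) >= 3 + |A| + |S|]. The sum over the label,
    [A] and [S] then factorizes, and each subset sum is at most 4. *)
Lemma internal_cuts_count (R : realType) (V L : finType) (k : nat) : (0 < k)%N ->
  \sum_(u : L * ({set V} * {set V}) | (u.2.1 != set0) && (#|u.2.2| < k)%N)
    (#|V|%:R^-1 : R) ^+ (#|u.2.1| * (k + 3)) <= #|L|%:R * (#|V|%:R^-1) ^+ 3 * 16.
Proof.
move=> k0; set q : R := #|V|%:R^-1.
have q0 : 0 <= q by rewrite invr_ge0.
have q1 : q <= 1.
  have [n0|n0] := posnP #|V|; first by rewrite /q n0 invr0.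
  by rewrite invf_le1 ?ltr0n // ler1n.
apply: (@le_trans _ _ (\sum_(u : L * ({set V} * {set V}))
    q ^+ 3 * (q ^+ #|u.2.1| * q ^+ #|u.2.2|))).
  rewrite big_mkcond /=; apply: ler_sum => -[i [A S]] _ /=.
  case: ifP => [/andP[A0 Sk]|_]; last by rewrite !mulr_ge0 ?exprn_ge0.
  rewrite -!exprD; apply: ler_wiXn2l => //.
  rewrite -card_gt0 in A0; nia.
have -> : \sum_(u : L * ({set V} * {set V})) q ^+ 3 * (q ^+ #|u.2.1| * q ^+ #|u.2.2|) =
  #|L|%:R * q ^+ 3 * ((\sum_(A : {set V}) q ^+ #|A|) * (\sum_(S : {set V}) q ^+ #|S|)).
  rewrite -mulr_sumr [in RHS]mulrAC [RHS]mulrC; congr (_ * _).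
  rewrite -(pair_bigA _ (fun (i : L) (v : {set V} * {set V}) => q ^+ #|v.1| * q ^+ #|v.2|)) /=.
  rewrite sumr_const mulr_natl; congr (_ *+ _).
  by rewrite -(pair_bigA _ (fun A S : {set V} => q ^+ #|A| * q ^+ #|S|)) big_distrlr.
rewrite ler_wpM2l ?mulr_ge0 ?exprn_ge0 //.
have h := sum_set_exp_le4 R V; rewrite -/q in h.
have : 0 <= \sum_(A : {set V}) q ^+ #|A| by apply: sumr_ge0 => A _; rewrite exprn_ge0.
nra.
Qed.

(** * Connectivity from edges across cuts *)

Lemma k_connected_of_hits (V L : finType) (k : nat) (phi : V -> L) (chi : V -> 'I_k)
    (E : {set {set V}}) : (k < #|V|)%N ->
  (forall i (A S : {set V}), A != set0 -> A \subset label_class phi i ->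
     (#|S| < k)%N -> (#|A| <= #|label_class phi i :\: (A :|: S)|)%N ->
     [disjoint A & S] ->
     exists x y, [/\ x \in A, y \in label_class phi i :\: (A :|: S) & [set x; y] \in E]) ->
  (forall i j c, i != j -> label_class phi i != set0 -> label_class phi j != set0 ->
     exists x y, [/\ x \in colour_class phi chi i c, y \in colour_class phi chi j c
                   & [set x; y] \in E]) ->
  k_connected k E.
Proof.
move=> kV internal cross; rewrite /k_connected kV /=.
apply/forallP => S; apply/implyP => Sk.
set e := [rel x y | [&& x \notin S, y \notin S & [set x; y] \in E]].
have esym : connect_sym e.
  by apply: sym_connect_sym => x y /=; rewrite setUC andbCA.
have within i u v : u \notin S -> v \notin S -> phi u = i -> phi v = i -> connect e u v.
  move=> uS vS ui vi; apply: contraT => nuv.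
  (* [A] is the part of the class reachable from [u] after deleting [S], and [B] is the remaining
     part; no edge can join them. *)
  pose A := [set z in label_class phi i | (z \notin S) && connect e u z].
  pose B := label_class phi i :\: (A :|: S).
  have Ai : A \subset label_class phi i.
    by apply/subsetP => z; rewrite inE => /andP[].
  have AS : [disjoint A & S].
    rewrite -setI_eq0; apply/eqP/setP => z; rewrite !inE.
    by case: (z \in S); rewrite ?andbF.
  have uA : u \in A by rewrite !inE ui eqxx uS connect0.
  have vB : v \in B by rewrite !inE vi eqxx (negbTE nuv) (negbTE vS).
  have BS : [disjoint B & S].
    rewrite -setI_eq0; apply/eqP/setP => z; rewrite !inE.
    by case: (z \in S); rewrite ?andbF ?orbT.
  have AE : label_class phi i :\: (B :|: S) = A.
    apply/setP => z; rewrite !inE.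
    by case: (z \in S); case: (phi z == i); case: (connect e u z).
  have noedge x y : x \in A -> y \in B -> [set x; y] \in E -> False.
    rewrite !inE => /andP[xi /andP[xS ux]] /andP[+ yi] xyE.
    rewrite yi /= negb_or => /andP[+ yS]; rewrite yS /= => /negP; apply.
    by apply: connect_trans ux (connect1 _); rewrite /= xS yS.
  (* [internal] provides edges leaving the smaller side only, so the roles swap when [B] is
     smaller. *)
  have [AB|BA] := leqP #|A| #|B|.
    have A0 : A != set0 by apply/set0Pn; exists u.
    have [x [y [xA yB xy]]] := internal i A S A0 Ai Sk AB AS.
    by case: (noedge x y).
  have B0 : B != set0 by apply/set0Pn; exists v.
  have := internal i B S B0 (subsetDl _ _) Sk; rewrite AE => /(_ (ltnW BA) BS).
  case=> x [y [xB yA xy]].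
  by case: (noedge y x) => //; rewrite setUC.
apply/forallP => u; apply/implyP; rewrite inE => uS.
apply/forallP => v; apply/implyP; rewrite inE => vS.
have [uv|uv] := eqVneq (phi u) (phi v); first exact: (within (phi v)).
(* Fewer than [k] deleted vertices cannot carry all [k] colours. *)
have [c cS] : exists c, c \notin chi @: S.
  apply/existsP; rewrite -negb_forall; apply/negP => /forallP all_in.
  have := leq_imset_card chi S; rewrite (eq_card (all_in : chi @: S =i predT)).
  by rewrite card_ord leqNgt Sk.
have notS i x : x \in colour_class phi chi i c -> phi x = i /\ x \notin S.
  rewrite !inE => /andP[/eqP -> /eqP xc]; split=> //.
  by apply: contra cS => xS; rewrite -xc imset_f.
have u0 : label_class phi (phi u) != set0 by apply/set0Pn; exists u; rewrite inE.
have v0 : label_class phi (phi v) != set0 by apply/set0Pn; exists v; rewrite inE.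
have [x [y [/notS[xu xS] /notS[yv yS] xy]]] := cross _ _ c uv u0 v0.
apply: (connect_trans (within (phi u) u x uS xS erefl xu)).
apply: (@connect_trans _ _ y); first by apply: connect1; rewrite /= xS yS.
exact: (within (phi v)).
Qed.

(** * Maker's game on the cuts, and the sizes of these cuts *)

Definition class_pair (V L : finType) (k : nat) (phi : V -> L) (v : (L * L) * 'I_k) : bool :=
  [&& v.1.1 != v.1.2, label_class phi v.1.1 != set0 & label_class phi v.1.2 != set0].

(** With [u = (i, (A, S))], the set [A] is a side, not the larger one, of a cut of class [i] after
    the vertices of [S] are deleted. *)
Definition internal_cut (V L : finType) (k : nat) (phi : V -> L)
    (u : L * ({set V} * {set V})) : bool :=
  [&& u.2.1 != set0, (#|u.2.2| < k)%N, u.2.1 \subset label_class phi u.1,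
      [disjoint u.2.1 & u.2.2]
    & (#|u.2.1| <= #|label_class phi u.1 :\: (u.2.1 :|: u.2.2)|)%N].

(** The hitting criterion is applied to both kinds of cuts. Internal cuts weigh at most
    [n ^ - ((k + 3) * |A|)] each and less than 1/4 in total; cuts between classes weigh at most
    [expR (- t)] each and at most 1/4 in total. *)
Lemma maker_wins_of_dense_cuts (R : realType) (V : finType) (X : {set {set V}})
    (k b : nat) (phi : V -> option V) (chi : V -> 'I_k) (t : R) :
  (0 < k)%N -> (0 < b)%N -> (16 <= #|V|)%N -> (k < #|V|)%N ->
  (forall u, internal_cut k phi u ->
     2 * b%:R * ((k + 3)%:R * ln (#|V|%:R)) * #|u.2.1|%:R <=
     #|cut_edges X u.2.1 (label_class phi u.1 :\: (u.2.1 :|: u.2.2))|%:R :> R) ->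
  (forall v, class_pair phi v ->
     2 * b%:R * t <= #|cut_edges X (colour_class phi chi v.1.1 v.2)
                             (colour_class phi chi v.1.2 v.2)|%:R) ->
  #|[pred v | class_pair (k := k) phi v]|%:R * expR (- t) <= 4^-1 ->
  forall first, maker_wins b X (k_connected_subgraphs k X) first.
Proof.
move=> k0 b0 n16 kn internal cross count first.
set n := #|V| in n16 kn internal *.
have b0' : 0 < 2 * b%:R :> R by rewrite mulr_gt0 ?ltr0n.
have n0 : 0 < n%:R :> R by rewrite ltr0n (leq_trans _ n16).
pose cutI u := cut_edges X u.2.1 (label_class phi u.1 :\: (u.2.1 :|: u.2.2)).
pose cutX v := cut_edges X (colour_class phi chi v.1.1 v.2) (colour_class phi chi v.1.2 v.2).
pose F := [seq cutI u | u <- enum (internal_cut k phi)] ++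
          [seq cutX v | v <- enum (class_pair (k := k) phi)].
have FX A : A \in F -> A \subset X.
  by rewrite mem_cat => /orP[] /mapP[? _ ->]; exact: cut_sub.
have weightI : \sum_(u | internal_cut k phi u)
    expR (- (#|cutI u|%:R / (2 * b%:R))) < 4^-1 :> R.
(* This amounts to [64 * (n + 1) < n ^ 3], true from [n = 16] on. *)
have bound : #|{: option V}|%:R * (n%:R^-1) ^+ 3 * 16 < 4^-1 :> R.
    rewrite card_option -/n.
    have n16' : 16 <= n%:R :> R by rewrite ler_nat.
    have -> : n.+1%:R * n%:R^-1 ^+ 3 * 16 = (16 * (1 + n%:R)) / n%:R ^+ 3 :> R.
      by rewrite -addn1 natrD exprVn; ring.
    rewrite ltr_pdivrMr ?exprn_gt0 // !exprS expr0 mulr1; nra.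
  apply: le_lt_trans bound; apply: le_trans (internal_cuts_count R V (option V) k0).
  rewrite [leLHS]big_mkcond [leRHS]big_mkcond /=; apply: ler_sum => u _.
  case: ifP => [iu|_]; last by case: ifP => // _; rewrite exprn_ge0 ?invr_ge0 ?ler0n.
  have /and3P[-> -> _] := iu; rewrite /= -/n.
  rewrite -[n%:R^-1]lnK ?posrE ?invr_gt0 // -expRM_natl ler_expR lnV ?posrE //.
  rewrite lerNl -mulrN opprK ler_pdivlMr //.
  by apply: le_trans (internal u iu); rewrite natrM; lra.
have weightX : \sum_(v | class_pair (k := k) phi v)
    expR (- (#|cutX v|%:R / (2 * b%:R))) <= 4^-1 :> R.
  apply: le_trans count; rewrite [leRHS]mulr_natl -[leRHS]sumr_const; apply: ler_sum => v cv.
  by rewrite ler_expR lerN2 ler_pdivlMr // mulrC cross.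
have small : \sum_(A <- F) expR (- (#|A|%:R / (2 * b%:R))) < 2^-1 :> R.
  rewrite big_cat !big_map !big_enum /=.
  by apply: lt_le_trans (ltr_leD weightI weightX) _; lra.
have [sigma legal hits] := hitting_criterion set0 b0 FX small first.
exists sigma => // pl h hplay hend.
have {}hits A : A \in F -> exists2 e, e \in A & e \in X :&: maker_claimed h.
  move=> AF; have [e eA eM] := hits pl h hplay hend A AF; exists e => //.
  by rewrite inE eM (subsetP (FX _ AF)).
exists (X :&: maker_claimed h); last exact: subsetIr.
rewrite inE subsetIl /=; apply: (@k_connected_of_hits _ _ _ phi chi) => //.
  move=> i A S A0 Ai Sk AB AS.
  have [|e /in_cut[x [y [xA yB ->]]] eM] := hits (cutI (i, (A, S))); last by exists x, y.
  rewrite mem_cat map_f // mem_enum; exact/and5P.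
move=> i j c ij i0 j0.
have [|e /in_cut[x [y [xA yB ->]]] eM] := hits (cutX ((i, j), c)); last by exists x, y.
rewrite mem_cat orbC map_f // mem_enum; exact/and3P.
Qed.

(** As [A] is no larger than the rest of its class, that rest has at least [alpha / 4 * n] vertices,
    giving [alpha ^ 2 / 8 * n * |A|] adjacencies. Deleting [S] destroys at most [k * |A|] of them,
    at most half. *)
Lemma robust_cut (R : realType) (V L : finType) (G : {set {set V}}) (k : nat)
    (phi : V -> L) (alpha : R) u :
  0 <= alpha -> k%:R <= alpha ^+ 2 * #|V|%:R / 16 ->
  (forall i, label_class phi i != set0 ->
     alpha / 2 * #|V|%:R <= #|label_class phi i|%:R) ->
  (forall i (A : {set V}), A \subset label_class phi i ->
     alpha / 2 * #|A|%:R * #|label_class phi i :\: A|%:R <=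
     (adjacencies G A (label_class phi i :\: A))%:R) ->
  internal_cut k phi u ->
  alpha ^+ 2 / 16 * #|V|%:R * #|u.2.1|%:R <=
  (adjacencies G u.2.1 (label_class phi u.1 :\: (u.2.1 :|: u.2.2)))%:R.
Proof.
case: u => i [A S] a0 kn large dense /and5P[/= A0 Sk Ai AS AB].
set W := label_class phi i in Ai AB *; set B := W :\: (A :|: S) in AB *.
have W0 : W != set0 by apply: contraNneq A0 => W0; rewrite W0 subset0 in Ai.
have BW : B \subset W :\: A by rewrite setDS // subsetUl.
have := dense _ _ Ai; rewrite -/W (adjacencies_subr _ _ BW) natrD.
have : (adjacencies G A ((W :\: A) :\: B))%:R <= #|A|%:R * k%:R :> R.
  rewrite -natrM ler_nat (leq_trans (adjacencies_le _ _ _)) // leq_mul2l.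
  apply/orP; right; apply: leq_trans (ltnW Sk); apply: subset_leq_card.
  apply/subsetP => x; rewrite !in_setD in_setU.
  by case: (x \in S); case: (x \in A); case: (x \in W).
have := large _ W0; rewrite -/W -(cardsID A W) (setIidPr Ai) natrD.
have : #|A|%:R <= #|W :\: A|%:R :> R.
  by rewrite ler_nat (leq_trans AB) // subset_leq_card.
have := ler0n R #|A|; set a := #|A|%:R; set w := #|W :\: A|%:R.
set n := #|V|%:R in kn *; move=> ha aw wn adjS adj.
have wn4 : alpha / 4 * n <= w by lra.
have h1 : alpha / 2 * a * (alpha / 4 * n) <= alpha / 2 * a * w.
  by rewrite ler_wpM2l // mulr_ge0 // divr_ge0.
have h2 : a * k%:R <= a * (alpha ^+ 2 * n / 16) by rewrite ler_wpM2l.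
rewrite expr2 in h2 *; lra.
Qed.

Lemma card_nonempty_classes (R : realType) (V L : finType) (phi : V -> L) (s : R) :
  0 < s -> (0 < #|V|)%N ->
  (forall i, label_class phi i != set0 -> s * #|V|%:R <= #|label_class phi i|%:R) ->
  #|[set i | label_class phi i != set0]|%:R <= s^-1.
Proof.
move=> s0 n0 large; have n0' : 0 < #|V|%:R :> R by rewrite ltr0n.
rewrite -[leRHS]mul1r ler_pdivlMr // -(ler_pM2r n0') mul1r -mulrA mulr_natl.
rewrite -sumr_const; apply: (@le_trans _ _ (\sum_i #|label_class phi i|%:R)).
  rewrite [leRHS](bigID (mem [set i | label_class phi i != set0])) /=.
  rewrite -[leLHS]addr0; apply: lerD; last by apply: sumr_ge0.
  by apply: ler_sum => i; rewrite inE => /large.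
rewrite -natr_sum ler_nat -[leqRHS]sum1_card (partition_big phi xpredT) //=.
by apply: leq_sum => i _; rewrite -sum1_card; apply: eq_leq; apply: eq_bigl => x; rewrite inE.
Qed.

Lemma card_class_pairs (V L : finType) (k : nat) (phi : V -> L) :
  (#|[pred v | class_pair (k := k) phi v]| <=
   #|[set i | label_class phi i != set0]| ^ 2 * k)%N.
Proof.
have -> : (#|[set i | label_class phi i != set0]| ^ 2 * k =
    #|setX (setX [set i | label_class phi i != set0] [set i | label_class phi i != set0])
           [set: 'I_k]|)%N.
  by rewrite !cardsX cardsT card_ord expnS expn1.
apply: subset_leq_card.
by apply/subsetP => -[[i j] c]; rewrite !inE /= => /and3P[_ /= -> ->].
Qed.

(** * Choice of constants and assembly *)

Theorem theorem1p3 (R : realType) (alpha : R) (k : nat)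
    (halpha : 0 < alpha) (hk : (1 <= k)%N) :
  exists C c : R, [/\ 0 < C, 0 < c &
    exists n0 : nat, forall n : nat, (n0 <= n)%N ->
      forall (V : finType) (G : {set {set V}}),
        #|V| = n -> is_graph G ->
        alpha * n%:R <= (min_degree G)%:R ->
      forall b : nat, (0 < b)%N -> b%:R <= c * n%:R / ln (n%:R : R) ->
      forall p : R, C * b%:R / n%:R ^+ 2 <= p -> p <= 1 ->
        1 - expR (- (c * p * n%:R ^+ 2)) <=
        gnp_prob p (fun H : {set {set V}} =>
          forall first : player,
            maker_wins b (G :|: H) (k_connected_subgraphs k (G :|: H)) first)].
Proof.
have k0 : 0 < k%:R :> R by rewrite ltr0n.
(* [M] bounds the number of pairs of classes with a colour, and [gamma * n ^ 2] bounds from below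
   the number of vertex pairs between two colour classes. In [c], the first term serves the failure
   probability, the second the logarithm in the internal cuts. *)
pose M : R := (alpha / 2)^-1 ^+ 2 * k%:R.
pose gamma : R := (alpha / (4 * k%:R)) ^+ 2.
pose c : R := Num.min (gamma / 8) (alpha ^+ 2 / (32 * (k + 3)%:R)).
have M0 : 0 < M by rewrite mulr_gt0 // exprn_gt0 // invr_gt0 divr_gt0.
have gamma0 : 0 < gamma by rewrite exprn_gt0 // divr_gt0 // mulr_gt0.
have k30 : 0 < (k + 3)%:R :> R by rewrite ltr0n addn3.
have c0 : 0 < c.
  rewrite lt_min; apply/andP; split; apply: divr_gt0 => //.
  - exact: exprn_gt0.
  - exact: mulr_gt0.
have cgamma : c <= gamma / 8 by rewrite ge_min lexx.
have ck : c <= alpha ^+ 2 / (32 * (k + 3)%:R) by rewrite ge_min lexx orbT.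
exists (40 * M / gamma), c; split => //; first by apply: divr_gt0 => //; exact: mulr_gt0.
(* The summands ensure in turn [n >= 16], [n > k], few deleted vertices in [robust_cut], and colour
   classes large enough to absorb rounding. *)
pose x := 16 + k%:R + 16 * k%:R / alpha ^+ 2 + 4 * k%:R / alpha.
have x1 : 0 <= 16 * k%:R / alpha ^+ 2 by rewrite divr_ge0 ?exprn_ge0 ?mulr_ge0 ?ltW.
have x2 : 0 <= 4 * k%:R / alpha by rewrite divr_ge0 ?mulr_ge0 ?ltW.
exists (Num.truncn x).+1 => ? n0n V G Vn; move: n0n; rewrite -{}Vn => n0n.
move=> gG mindeg b b0 bn p Cp p1.
have xn : x < #|V|%:R by apply: lt_le_trans (truncnS_gt x) _; rewrite ler_nat.
have n16k : (16 + k <= #|V|)%N by rewrite -(ler_nat R) natrD; rewrite /x in xn; lra.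
have n16 : (16 <= #|V|)%N by apply: leq_trans n16k; exact: leq_addr.
have ltkn : (k < #|V|)%N by apply: leq_trans n16k; rewrite addSn ltnS leq_addl.
have n0 : 0 < #|V|%:R :> R by rewrite ltr0n (leq_trans _ n16).
have b0' : 1 <= b%:R :> R by rewrite ler1n.
have kn : k%:R <= alpha ^+ 2 * #|V|%:R / 16.
  have : 16 * k%:R / alpha ^+ 2 <= #|V|%:R by rewrite /x in xn; lra.
  by rewrite ler_pdivrMr ?exprn_gt0 //; lra.
have kn2 : 1 <= alpha * #|V|%:R / (4 * k%:R).
  have : 4 * k%:R / alpha <= #|V|%:R by rewrite /x in xn; lra.
  by rewrite ler_pdivrMr // ler_pdivlMr ?mulr_gt0 //; lra.
have blog : b%:R * ln #|V|%:R <= c * #|V|%:R :> R.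
  by rewrite -ler_pdivlMr // ln_gt0 // ltr1n (leq_trans _ n16).
have Y : 40 * M * b%:R <= gamma * p * #|V|%:R ^+ 2.
  move: Cp; rewrite ler_pdivrMr ?exprn_gt0 // mulrAC ler_pdivrMr //; lra.
have p0 : 0 <= p.
  apply: le_trans Cp; apply: divr_ge0; last exact: sqr_ge0.
  by apply: mulr_ge0 => //; apply: divr_ge0; [apply: mulr_ge0 => // |]; exact: ltW.
have [phi [large dense]] := robust_partition (ltW halpha) gG mindeg.
have [chi balanced] := balanced_colouring phi hk.
have countM : #|[pred v | class_pair (k := k) phi v]|%:R <= M.
  apply: (@le_trans _ _ (#|[set i | label_class phi i != set0]| ^ 2 * k)%:R).
    by rewrite ler_nat card_class_pairs.
  rewrite natrM natrX ler_wpM2r // lerXn2r ?nnegrE ?invr_ge0 ?divr_ge0 ?(ltW halpha) //.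
  by apply: card_nonempty_classes => //; [rewrite divr_gt0 | rewrite (leq_trans _ n16)].
pose D v := cut_edges (pairs V) (colour_class phi chi v.1.1 v.2)
  (colour_class phi chi v.1.2 v.2).
have disj v : class_pair phi v ->
    [disjoint colour_class phi chi v.1.1 v.2 & colour_class phi chi v.1.2 v.2].
  move=> /and3P[ij _ _]; rewrite -setI_eq0; apply/eqP/setP => z; rewrite !inE.
  by case: eqVneq => //= ->; rewrite (negbTE ij) andbF.
have colour_large i d : label_class phi i != set0 ->
    alpha / (4 * k%:R) * #|V|%:R <= #|colour_class phi chi i d|%:R.
  move=> i0; have := large _ i0; have := balanced i d.
  rewrite -(ler_nat R) natrM -addn1 natrD => h1 h2.
  have h3 : alpha / 2 * #|V|%:R <= k%:R * (#|colour_class phi chi i d|%:R + 1).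
    exact: le_trans h1.
  have h4 : alpha / 2 * #|V|%:R = k%:R * (2 * (alpha * #|V|%:R / (4 * k%:R))).
    by field; rewrite gt_eqF.
  (* With [y = alpha * n / (4 * k) >= 1], a colour class has at least [2 * y - 1 >= y] vertices. *)
  move: h3; rewrite h4 ler_pM2l // => h3.
  by rewrite mulrAC; lra.
have cardD v : class_pair phi v -> gamma * #|V|%:R ^+ 2 <= #|D v|%:R.
  move=> cv; have /and3P[_ i0 j0] := cv.
  have -> : #|D v| = (#|colour_class phi chi v.1.1 v.2| * #|colour_class phi chi v.1.2 v.2|)%N.
    rewrite card_cut ?disj // /adjacencies -sum_nat_const; apply: eq_bigr => y yi.
    rewrite -[RHS]muln1 -sum_nat_const; apply: eq_bigr => z zj.
    rewrite inE cards2 (_ : y != z) //; apply/eqP => yz.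
    by have /setP/(_ y) := disjoint_setI0 (disj _ cv); rewrite inE yi yz zj inE.
  rewrite -exprMn expr2 natrM; apply: ler_pM; rewrite ?colour_large //.
  - by rewrite mulr_ge0 ?divr_ge0 ?mulr_ge0 ?ltW.
  - by rewrite mulr_ge0 ?divr_ge0 ?mulr_ge0 ?ltW.
set Z := gamma * p * #|V|%:R ^+ 2 in Y.
have Mb : M <= M * b%:R by rewrite ler_peMr // ltW.
(* The threshold is [2 * b * t] for the value [t = 4 * M] used in the game below. *)
apply: le_trans (@gnp_prob_ge R V p _ (class_pair (k := k) phi) D (8 * M * b%:R) _ p0 p1 _ _).
- rewrite lerD2l lerN2.
  apply: (@le_trans _ _ (M * expR (8 * M * b%:R - Z / 2))).
    apply: (@le_trans _ _ (#|[pred v | class_pair (k := k) phi v]|%:R *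
        expR (8 * M * b%:R - Z / 2))).
      rewrite [leRHS]mulr_natl -[leRHS]sumr_const; apply: ler_sum => v cv.
      rewrite ler_expR lerD2l lerN2 ler_pM2r ?invr_gt0 //.
      have -> : Z = p * (gamma * #|V|%:R ^+ 2) by rewrite /Z; ring.
      by rewrite ler_wpM2l // cardD.
    by rewrite ler_wpM2r ?expR_ge0.
  (* [M <= expR M] moves the number of events into the exponent. *)
  apply: (@le_trans _ _ (expR M * expR (8 * M * b%:R - Z / 2))).
    by rewrite ler_wpM2r ?expR_ge0 //; have := expR_ge1Dx M; lra.
  rewrite -expRD ler_expR.
  have : c * p * #|V|%:R ^+ 2 <= gamma / 8 * (p * #|V|%:R ^+ 2).
    by rewrite -mulrA ler_wpM2r // mulr_ge0 // exprn_ge0 // ltW.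
  have -> : gamma / 8 * (p * #|V|%:R ^+ 2) = Z / 8 by rewrite /Z; ring.
  (* The factor 40 in [C] suffices: [m + 8 * mb <= 9 * mb <= 9 / 40 * z], below
     [z / 2 - z / 8 = 15 / 40 * z]. *)
  have exponents (m mb z y : R) : 0 <= m -> m <= mb -> 40 * mb <= z -> y <= z / 8 ->
    m + (8 * mb - z / 2) <= - y by lra.
  by move=> cZ; rewrite -(mulrA 8); apply: exponents cZ; [exact: ltW|exact: Mb|rewrite mulrA].
- by move=> v _; exact: cut_sub.
(* [G] alone supplies the edges of internal cuts, and [H] alone those between classes. The choice
   [t = 4 * M] works since [expR (4 * M) >= 4 * M]. *)
move=> H manyH; apply: (@maker_wins_of_dense_cuts R V _ k b phi chi (4 * M)) => //.
- move=> u iu; apply: (@le_trans _ _ (adjacencies G u.2.1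
      (label_class phi u.1 :\: (u.2.1 :|: u.2.2)))%:R).
    apply: le_trans (robust_cut (ltW halpha) kn large dense iu).
    rewrite ler_wpM2r //.
    have : b%:R * ln #|V|%:R <= alpha ^+ 2 / (32 * (k + 3)%:R) * #|V|%:R.
      by apply: le_trans blog _; rewrite ler_pM2r.
    move=> /(ler_wpM2l (mulr_ge0 (ler0n R 2) (ltW k30))).
    have cancel (K a m : R) : 0 < K -> 2 * K * (a / (32 * K) * m) = a / 16 * m.
      by move=> K0; field; rewrite gt_eqF.
    rewrite (cancel _ _ _ k30); lra.
  rewrite ler_nat card_cut; first by apply: adjacencies_mono; exact: subsetUl.
  rewrite -setI_eq0; apply/eqP/setP => z; rewrite !inE.
  by case: (z \in u.2.1); rewrite ?andbF.
- move=> v cv; apply: (@le_trans _ _ #|H :&: D v|%:R).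
    by apply: le_trans (manyH v cv); lra.
  rewrite ler_nat; apply: subset_leq_card; apply/subsetP => e.
  by rewrite !inE => /andP[-> /andP[_ ->]]; rewrite orbT.
rewrite expRN; apply: (@le_trans _ _ (M / (4 * M))); last first.
  by rewrite invfM mulrCA divff ?mulr1 ?gt_eqF.
apply: ler_pM => //; first by rewrite invr_ge0 expR_ge0.
rewrite lef_pV2 ?posrE ?expR_gt0 //; last exact: mulr_gt0.
by have := expR_ge1Dx (4 * M); lra.
Qed.
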